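(* Let $V,E,L$ be positive integers with $L\ge (2E)^4$. Consider a random GBS graph with $V$ vertices, $E$ edges and labels chosen independently and uniformly in $\{\pm1,\pm2,\dots,\pm L\}$, conditioned on the graph being connected. Then the GBS graph is rigid with probability at least $1-\frac{1}{\sqrt[4]{L}}$.
   Context: A graph $\Gamma$ consists of a vertex set $V(\Gamma)$, a set $E(\Gamma)$ of (oriented) edges, a reverse map $e\mapsto\overline{e}$ on $E(\Gamma)$ with $\overline{e}\neq e$ and $\overline{\overline{e}}=e$, and an initial vertex map $\iota:E(\Gamma)\to V(\Gamma)$; the terminal vertex is $\tau(e)=\iota(\overline{e})$. A topological edge is a pair $\{e,\overline e\}$. Loops and multiple edges are allowed. A GBS graph is a pair $(\Gamma,\psi)$ with $\Gamma$ a finite graph and $\psi:E(\Gamma)\to\mathbb{Z}\setminus\{0\}$; $\psi(e)$ is the label on $e$ near $\tau(e)$. It is called rigid if there are no distinct edges $e,e'\in E(\Gamma)$ such that $\tau(e)=\tau(e')$ and $\psi(e)\mid\psi(e')$. Random model: the vertex set is $[V]=\{1,\dots,V\}$. Let $v_1,\dots,v_{2E}$ be independent and uniform in $[V]$; the $E$ topological edges join $v_{2i-1}$ to $v_{2i}$, $i=1,\dots,E$ (a loop if these coincide), so there are $2E$ oriented edges. Independently of the graph, each of the $2E$ oriented edges receives a label, the $2E$ labels being independent and uniform in $\{\pm1,\pm2,\dots,\pm L\}$. The parameters are such that the event that the graph is connected has positive probability (i.e. $E\ge V-1$). *)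

(* Defs.v *)
From HB Require Import structures.
From mathcomp Require Import all_boot all_order all_algebra.
From mathcomp Require Import reals.

Set Implicit Arguments.
Unset Strict Implicit.
Unset Printing Implicit Defensive.

Import Order.TTheory GRing.Theory Num.Theory.

Local Open Scope ring_scope.

(* Finite graphs with oriented edges; loops and multiple edges are allowed. *)
Record fgraph := FGraph {
  vertex : finType;
  edge : finType;
  rev_edge : edge -> edge;
  rev_edge_neq : forall e, rev_edge e != e;
  rev_edgeK : involutive rev_edge;
  initial : edge -> vertex }.

Definition terminal (G : fgraph) (e : edge G) : vertex G :=
  initial (rev_edge e).

Definition adjacent (G : fgraph) : rel (vertex G) :=
  fun x y => [exists e : edge G, (initial e == x) && (terminal e == y)].

(* [connect] is the reflexive transitive closure, so this asks for an edge path
   between any two vertices. *)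
Definition is_connected (G : fgraph) : bool :=
  [forall x : vertex G, forall y : vertex G, connect (@adjacent G) x y].

(* [psi e] is the label on [e] near [terminal e]. *)
Record gbs_graph := GBSGraph {
  gbs_base :> fgraph;
  psi : edge gbs_base -> int;
  psi_neq0 : forall e, psi e != 0 }.

Definition rigid (G : gbs_graph) : bool :=
  ~~ [exists e : edge G, exists e' : edge G,
        [&& e != e', terminal e == terminal e' & (psi e %| psi e')%Z]].

(* The oriented edges are the pairs [(i, b)] with [i < E], where [(i, false)]
   and [(i, true)] are the two orientations of the [i]-th topological edge.
   The [2 * E] random endpoints are indexed in the same way: with topological
   edges numbered from 1, [v (i - 1, false)] is v_(2i-1), [v (i - 1, true)] is
   v_(2i), and the endpoint of index [h] is the initial vertex of [h]. *)
Definition oedge (E : nat) : finType := ('I_E * bool)%type.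

Definition oedge_rev (E : nat) (h : oedge E) : oedge E := (h.1, ~~ h.2).

Lemma oedge_rev_neq (E : nat) (h : oedge E) : oedge_rev h != h.
Proof. by case: h => i []; rewrite /oedge_rev xpair_eqE andbF. Qed.

Lemma oedge_revK (E : nat) : involutive (@oedge_rev E).
Proof. by case=> i b; rewrite /oedge_rev /= negbK. Qed.

Definition graph_of_endpoints (V E : nat) (v : {ffun oedge E -> 'I_V}) :
    fgraph :=
  FGraph (@oedge_rev_neq E) (@oedge_revK E) v.

(* [(s, k)] encodes the integer (-1)^s (k + 1); this is a bijection from
   [bool * 'I_L] to {1, -1, 2, -2, ..., L, -L}. *)
Definition label (L : nat) : finType := (bool * 'I_L)%type.

Definition label_val (L : nat) (a : label L) : int :=
  (-1) ^+ a.1 * (a.2.+1)%:Z.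

Lemma label_val_neq0 (L : nat) (a : label L) : label_val a != 0.
Proof. by rewrite /label_val mulf_neq0 // signr_eq0. Qed.

Definition outcome (V E L : nat) : finType :=
  ({ffun oedge E -> 'I_V} * {ffun oedge E -> label L})%type.

Definition random_gbs (V E L : nat) (w : outcome V E L) : gbs_graph :=
  @GBSGraph (graph_of_endpoints w.1) (fun e => label_val (w.2 e))
    (fun e => label_val_neq0 (w.2 e)).

Definition uniform_pmf (R : realType) (T : finType) (x : T) : R :=
  #|T|%:R^-1.

(* The joint law of the [2 * E] endpoints and the [2 * E] labels: all of them
   are independent, each being uniform on its range. *)
Definition outcome_pmf (R : realType) (V E L : nat) (w : outcome V E L) : R :=
  (\prod_(h : oedge E) uniform_pmf R (w.1 h)) *
  (\prod_(h : oedge E) uniform_pmf R (w.2 h)).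

Definition Prob (R : realType) (V E L : nat) (A : {set outcome V E L}) : R :=
  \sum_(w in A) outcome_pmf R w.

(* Equal to 0 when [B] has probability 0. *)
Definition CondProb (R : realType) (V E L : nat) (A B : {set outcome V E L}) :
    R :=
  Prob R (A :&: B) / Prob R B.

(* Main.v *)
(* Condition on the endpoints: the labels stay independent and uniform, so it is
   enough to bound, uniformly in the graph, the probability that among the
   n = 2E labels two have one dividing the other. A union bound over unordered
   pairs gives n (n - 1) / 2 * (2 D - L) / L^2, where D is the sum of the
   floor (L / a) for a <= L, that is, the number of pairs (a, b) with a | b in
   {1, ..., L}. The crude bound D <= L H_L is too weak when n = 4 and L = 256
   (H_k the harmonic sum), so D is estimated by Dirichlet's hyperbola method:
   D <= L (2 H_t - 1 + ln (L / t^2)) whenever t^2 <= L. Taking t = n^2, the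
   theorem reduces to (n - 1) (4 H_(n^2) - 3) <= 2 n^2. *)
Require Import Defs.
From HB Require Import structures.
From mathcomp Require Import all_boot all_order all_algebra.
From mathcomp Require Import ring lra zify.
From mathcomp Require Import reals exp.

Set Implicit Arguments.
Unset Strict Implicit.
Unset Printing Implicit Defensive.

Import Order.TTheory GRing.Theory Num.Theory.

Local Open Scope ring_scope.

(** * Lattice points under the hyperbola *)

Section DivisorSum.
Local Open Scope nat_scope.

Definition divisor_sum (L : nat) := \sum_(a < L) L %/ a.+1.

Lemma sum_ltn_ord (L q : nat) : \sum_(k < L) (k < q) = minn q L.
Proof.
elim: L => [|L IHL]; first by rewrite big_ord0 minn0.
by rewrite big_ord_recr /= IHL; case: (ltnP L q); lia.
Qed.

Lemma sum_dvdn_ord (L d : nat) : \sum_(b < L) (d %| b.+1) = L %/ d.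
Proof.
by rewrite divn_count_dvd big_add1 /= big_mkord.
Qed.

Lemma divn_count_mul (L a : nat) : L %/ a.+1 = \sum_(k < L) (a.+1 * k.+1 <= L).
Proof.
under eq_bigr => k _ do rewrite mulnC -leq_divRL //.
by rewrite sum_ltn_ord (minn_idPl _) // leq_div.
Qed.

(** With coordinates counted from 1, a point [(a, k)] with [a * k <= L < (s + 1)^2] has a coordinate
    at most [s], and the square where both are at most [s] lies under the hyperbola because
    [s^2 <= L]. The strip [a <= s] and its mirror image together count that square twice. *)
Lemma divisor_sum_hyperbola (L s : nat) : s ^ 2 <= L -> L < s.+1 ^ 2 ->
  divisor_sum L + s ^ 2 <= 2 * \sum_(a < s) L %/ a.+1.
Proof.
move=> le_sL lt_Ls.
have le_s_L : s <= L by nia.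
have -> : \sum_(a < s) L %/ a.+1 =
    \sum_(a < L) \sum_(k < L) (a < s) * (a.+1 * k.+1 <= L).
  rewrite (big_ord_widen L (fun a => L %/ a.+1)) // big_mkcond /=.
  apply: eq_bigr => a _; rewrite -big_distrr /= -divn_count_mul.
  by case: (a < s); rewrite ?mul1n ?mul0n.
have -> : s ^ 2 = \sum_(a < L) \sum_(k < L) (a < s) * (k < s).
  under eq_bigr => a _ do rewrite -big_distrr /=.
  by rewrite -big_distrl /= !sum_ltn_ord (minn_idPl _).
rewrite mul2n -addnn [X in _ <= _ + X]exchange_big /= -!big_split /=.
rewrite /divisor_sum; under eq_bigr => a _ do rewrite divn_count_mul.
apply: leq_sum => a _.
rewrite -!big_split /=; apply: leq_sum => k _.
rewrite [k.+1 * _]mulnC.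
case: (ltnP a s) => lt_as; case: (ltnP k s) => lt_ks;
  case: (leqP (a.+1 * k.+1) L) => //= le_akL; nia.
Qed.

(** Inclusion-exclusion: the two divisibilities hold together only on the diagonal, which has [L]
    points. *)
Lemma sum_dvdn_or_dvdn (L : nat) :
  \sum_(a < L) \sum_(b < L) ((a.+1 %| b.+1) || (b.+1 %| a.+1)) + L =
  2 * divisor_sum L.
Proof.
have D1 : divisor_sum L = \sum_(a < L) \sum_(b < L) (a.+1 %| b.+1).
  by apply: eq_bigr => a _; rewrite sum_dvdn_ord.
have D2 : L = \sum_(a < L) \sum_(b < L) (a == b).
  under eq_bigr => a _.
    rewrite (bigD1 a) //= eqxx big1 ?addn0; last first.
      by move=> b; rewrite eq_sym => /negbTE ->.
    over.
  by rewrite sum_nat_const card_ord muln1.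
have D1' : divisor_sum L = \sum_(a < L) \sum_(b < L) (b.+1 %| a.+1).
  by rewrite D1 exchange_big.
rewrite mul2n -addnn {1}D1 D1' [in X in _ + X = _]D2.
rewrite -!big_split; apply: eq_bigr => a _; rewrite -!big_split.
apply: eq_bigr => b _ /=; have -> : (a == b) = (a.+1 %| b.+1) && (b.+1 %| a.+1).
  by rewrite -eqn_dvd eqSS.
by case: (_ %| _); case: (_ %| _).
Qed.

Lemma exists_sqrtn (L : nat) : exists2 s, s ^ 2 <= L & L < s.+1 ^ 2.
Proof.
elim: L => [|L [s le_sL lt_Ls]]; first by exists 0.
case: (ltnP L.+1 (s.+1 ^ 2)) => [lt|le]; first by exists s => //; lia.
by exists s.+1 => //; nia.
Qed.
End DivisorSum.

(** * Union bound for functions on a finite set *)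

Section Collisions.
Local Open Scope nat_scope.
Variables (T K : finType) (r : rel K).

(** Two values are fixed and all others are free; the product form avoids the exponent
    [#|T| - 2]. *)
Lemma card_ffun_two_values (e e' : T) (a b : K) : e != e' ->
  #|[set f : {ffun T -> K} | (f e == a) && (f e' == b)]| * #|K| ^ 2 =
  #|K| ^ #|T|.
Proof.
move=> ne_ee'.
pose F h : pred K := if h == e then pred1 a else if h == e' then pred1 b else predT.
have -> : #|[set f : {ffun T -> K} | (f e == a) && (f e' == b)]| =
    #|(family F : simpl_pred {ffun T -> K})|.
  apply: eq_card => f; rewrite inE; apply/andP/familyP => [[fe fe'] h | Ff].
    rewrite /F; case: eqP => [->|_] //; case: eqP => [->|_] //.
  split; first by have := Ff e; rewrite /F eqxx.
  by have := Ff e'; rewrite /F eqxx eq_sym (negbTE ne_ee').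
rewrite card_family foldrE big_map big_enum /=.
rewrite (bigD1 e) //= (bigD1 e') 1?eq_sym //= /F eqxx eq_sym (negbTE ne_ee') eqxx.
rewrite !card1 !mul1n.
rewrite (eq_bigr (fun=> #|K|)); last first.
  by move=> h /andP[/negbTE-> /negbTE->].
have -> : #|K| ^ #|T| = \prod_(h : T) #|K| by rewrite prod_nat_const.
rewrite [RHS](bigD1 e) //= [X in _ = _ * X](bigD1 e') 1?eq_sym //=.
by rewrite mulnC -mulnA.
Qed.

Lemma card_ffun_rel (e e' : T) : e != e' ->
  #|[set f : {ffun T -> K} | r (f e) (f e')]| * #|K| ^ 2 =
  (\sum_a \sum_b r a b) * #|K| ^ #|T|.
Proof.
move=> ne_ee'.
have -> : #|[set f : {ffun T -> K} | r (f e) (f e')]| =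
    \sum_a \sum_b r a b * #|[set f : {ffun T -> K} | (f e == a) && (f e' == b)]|.
  rewrite pair_big /= -sum1_card big_mkcond /=.
  under [RHS]eq_bigr => p _ do rewrite -sum1_card big_distrr /= big_mkcond /=.
  rewrite exchange_big /=; apply: eq_bigr => f _.
  rewrite inE (bigD1 (f e, f e')) //= !inE !eqxx big1 ?addn0 ?muln1.
    by case: (r _ _).
  move=> [a b] /=; rewrite !inE xpair_eqE eq_sym [f e' == b]eq_sym [b == _]eq_sym.
  by rewrite eq_sym; case: ifP.
rewrite big_distrl big_distrl; apply: eq_bigr => a _ /=.
rewrite big_distrl big_distrl; apply: eq_bigr => b _ /=.
by rewrite -mulnA card_ffun_two_values.
Qed.

(** Union bound over ordered pairs. The leading 2 is gained because, [r] being symmetric, a bad [f]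
    is counted at both [(e, e')] and [(e', e)]. *)
Lemma card_ffun_collision : symmetric r ->
  2 * #|[set f : {ffun T -> K} | [exists e, exists e', (e != e') && r (f e) (f e')]]|
    * #|K| ^ 2 <=
  #|T| * #|T|.-1 * (\sum_a \sum_b r a b) * #|K| ^ #|T|.
Proof.
move=> r_sym.
set B := [set f | _].
have -> : #|T| * #|T|.-1 * (\sum_a \sum_b r a b) * #|K| ^ #|T| =
   (\sum_(e : T) \sum_(e' | e != e')
      #|[set f : {ffun T -> K} | r (f e) (f e')]|) * #|K| ^ 2.
  rewrite [RHS]big_distrl /= -!mulnA -sum_nat_const; apply: eq_bigr => e _.
  rewrite [RHS]big_distrl /= (eq_bigr _ (@card_ffun_rel e)) sum_nat_const.
  congr (_ * _); rewrite -(cardC1 e); apply: eq_card => h.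
  by rewrite !inE eq_sym.
rewrite leq_mul2r; apply/orP; right.
(* Double counting: exchanging the sums leaves, for each [f], the number of ordered pairs on which
   it collides. *)
under eq_bigr => e _.
  under eq_bigr => e' _ do rewrite -sum1_card big_mkcond.
  rewrite exchange_big /=; over.
rewrite exchange_big /= mulnC -sum_nat_const big_mkcond /=.
apply: leq_sum => f _; rewrite inE; case: existsP => // -[e /existsP[e' /andP[ne_ee' rf]]].
rewrite (bigD1 e) //= (bigD1 e') //= inE rf -addnA add1n ltnS.
rewrite [X in _ + X](bigD1 e') 1?eq_sym //= [X in _ + (X + _)](bigD1 e) 1?eq_sym //=.
rewrite !inE (r_sym (f e')) rf.
by rewrite addnCA addn_gt0.
Qed.
End Collisions.

(** * Harmonic sums and the size of the divisor sum *)

Section Harmonic.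
Variable R : realType.

Definition harmonic_sum (n : nat) : R := \sum_(i < n) i.+1%:R^-1.

Lemma harmonic_sumS n : harmonic_sum n.+1 = harmonic_sum n + n.+1%:R^-1.
Proof. by rewrite /harmonic_sum big_ord_recr. Qed.

Lemma ln_le_subr1 (x : R) : 0 < x -> ln x <= x - 1.
Proof.
move=> x_gt0; have := @le_ln1Dx R (x - 1).
by rewrite (_ : 1 + (x - 1) = x); [apply; lra | ring].
Qed.

(** Induction on [s]: the new term satisfies [1/(s+1) <= ln ((s+1)/s)], which is [ln y <= y - 1] at
    [y = s/(s+1)]. *)
Lemma harmonic_sum_ln (t s : nat) : (0 < t <= s)%N ->
  harmonic_sum s <= harmonic_sum t + ln (s%:R / t%:R).
Proof.
case/andP=> t_gt0; elim: s => [|s IHs]; first by lia.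
rewrite leq_eqVlt => /orP[/eqP <-|]; first by rewrite divff ?ln1 ?addr0 // pnatr_eq0; lia.
rewrite ltnS => le_ts.
have s_gt0 : (0 < s)%N by lia.
have t0 : 0 < t%:R :> R by rewrite ltr0n.
have s0 : 0 < s%:R :> R by rewrite ltr0n.
have s1 : 0 < s.+1%:R :> R by rewrite ltr0n.
have := IHs le_ts; rewrite harmonic_sumS !ln_div ?posrE //.
have := @ln_le_subr1 (s%:R / s.+1%:R) (divr_gt0 s0 s1).
rewrite ln_div ?posrE //.
have -> : s%:R / s.+1%:R = 1 - s.+1%:R^-1 :> R.
  by rewrite -natr1; field; rewrite natr1 gt_eqF.
by move: (ln s.+1%:R) (s.+1%:R^-1) => l d; lra.
Qed.

Lemma harmonic_sum_addn (m k : nat) :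
  harmonic_sum (m + k) <= harmonic_sum m + k%:R / m.+1%:R.
Proof.
elim: k => [|k IHk]; first by rewrite addn0 mul0r addr0.
rewrite addnS harmonic_sumS -[k.+1%:R]natr1 mulrDl mul1r addrA lerD //.
by rewrite lef_pV2 ?posrE ?ltr0n // ler_nat; lia.
Qed.

(** Checked directly up to [n = 5], then by induction: the [2 n + 1] terms between [n^2] and
    [(n + 1)^2] are each at most [1/(n^2 + 1)]. *)
Lemma harmonic_sum_square (n : nat) :
  (n.-1)%:R * (4 * harmonic_sum (n ^ 2) - 3) <= 2 * n%:R ^+ 2.
Proof.
case: n => [|[|[|[|[|n]]]]] /=; try by rewrite mul0r mulr_ge0 // sqr_ge0.
- by rewrite (_ : (2 ^ 2 = 4)%N) // !harmonic_sumS /harmonic_sum big_ord0; lra.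
- by rewrite (_ : (3 ^ 2 = 9)%N) // !harmonic_sumS /harmonic_sum big_ord0; lra.
- by rewrite (_ : (4 ^ 2 = 16)%N) // !harmonic_sumS /harmonic_sum big_ord0; lra.
elim: n => [|n IHn].
  by rewrite (_ : (5 ^ 2 = 25)%N) // !harmonic_sumS /harmonic_sum big_ord0; lra.
have := harmonic_sum_addn (n.+1.+4 ^ 2) (2 * n.+1.+4 + 1).
rewrite (_ : (_ + (_ + 1) = n.+1.+1.+4 ^ 2)%N); last by nia.
set h := harmonic_sum _ in IHn *; set h' := harmonic_sum _.
set N : R := n.+1.+4%:R.
have N_ge5 : 5 <= N by rewrite ler_nat; lia.
have eN1 : n.+4%:R = N - 1 :> R by rewrite /N -(natr1 n.+4); ring.
rewrite /= eN1 in IHn.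
rewrite -/N; have -> : n.+2.+4%:R = N + 1 :> R by rewrite natr1.
rewrite -(natr1 (_ ^ 2)) natrX natrD natrM -/N => le_h'.
(* The bound 9 amounts to [N^2 - 4 N + 9 >= 0]. *)
have le_d : 4 * (N * ((2 * N + 1) / (N ^+ 2 + 1))) <= 9.
  by rewrite !mulrA ler_pdivrMr; nra.
(* After multiplication by [N - 1] the induction hypothesis reduces this to [N >= 5], whence the
   constant 5/2. The step then closes by [5/2 + 9 <= 2 N + 2]. *)
have le_y : N * (4 * h - 3) <= 2 * N ^+ 2 + 2 * N + 5 / 2.
  by rewrite -(ler_pM2l (_ : 0 < N - 1)); nra.
have : N * h' <= N * (h + (2 * N + 1) / (N ^+ 2 + 1)) by rewrite ler_wpM2l; lra.
rewrite mulrDr; nra.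
Qed.

(** The hyperbola is cut at the integer square root [s] of [L]; replacing the harmonic sum at [s] by
    the one at [t] costs [ln (s / t)]. *)
Lemma divisor_sum_le (L t : nat) : (0 < t)%N -> (t ^ 2 <= L)%N ->
  (divisor_sum L)%:R <=
  L%:R * (2 * harmonic_sum t - 1 + ln (L%:R / t%:R ^+ 2)) :> R.
Proof.
move=> t_gt0 le_tL; have [s le_sL lt_Ls] := exists_sqrtn L.
have le_ts : (t <= s)%N by nia.
have := divisor_sum_hyperbola le_sL lt_Ls; rewrite -(ler_nat R).
rewrite natrD natrM natrX.
have floor_le : (\sum_(a < s) L %/ a.+1)%N%:R <= L%:R * harmonic_sum s.
  rewrite natr_sum /harmonic_sum mulr_sumr; apply: ler_sum => a _.
  by rewrite ler_pdivlMr ?ltr0n // -natrM ler_nat leq_trunc_div.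
have Hs : harmonic_sum s <= harmonic_sum t + ln (s%:R / t%:R).
  by apply: harmonic_sum_ln; rewrite t_gt0.
have s0 : 0 < s%:R :> R by rewrite ltr0n; lia.
have t0 : 0 < t%:R :> R by rewrite ltr0n.
have L0 : 0 < L%:R :> R by rewrite ltr0n; nia.
have := @ln_le_subr1 (s%:R ^+ 2 / L%:R) (divr_gt0 (exprn_gt0 _ s0) L0).
move: Hs; rewrite !ln_div ?posrE ?exprn_gt0 // !lnXn // => Hs Hln Hhyp.
(* The error from s^2 <> L is absorbed by [ln y <= y - 1] at [y = s^2 / L]. *)
have -> : L%:R * (2 * harmonic_sum t - 1 + (ln L%:R - ln t%:R *+ 2)) =
  2 * (L%:R * (harmonic_sum t + ln s%:R - ln t%:R)) - L%:R * (1 + (ln s%:R *+ 2 - ln L%:R)) :> R.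
  by ring.
have h1 : L%:R * (1 + (ln s%:R *+ 2 - ln L%:R)) <= s%:R ^+ 2 :> R.
  apply: le_trans (_ : L%:R * (s%:R ^+ 2 / L%:R) <= _).
    by rewrite (ler_wpM2l (ltW L0)) //; lra.
  by rewrite mulrC divfK // gt_eqF.
have h2 : L%:R * harmonic_sum s <= L%:R * (harmonic_sum t + ln s%:R - ln t%:R) :> R.
  by rewrite (ler_wpM2l (ltW L0)) //; lra.
lra.
Qed.

(** Division by [2 L^2 = 2 x^8] turns the right-hand side into [1/x], the failure probability
    sought. *)
Lemma divisor_sum_fourth_root (L n : nat) (x : R) : (0 < n)%N -> (n ^ 4 <= L)%N ->
  0 < x -> x ^+ 4 = L%:R ->
  (n * n.-1)%:R * (2 * (divisor_sum L)%:R - L%:R) <= 2 * x ^+ 7.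
Proof.
move=> n_gt0 le_nL x_gt0 xL.
have n0 : 0 < n%:R :> R by rewrite ltr0n.
have le_nx : n%:R <= x.
  by rewrite -(@ler_pXn2r _ 4) ?nnegrE ?(ltW n0) ?(ltW x_gt0) // xL -natrX ler_nat.
have := @divisor_sum_le L (n ^ 2); rewrite -expnM expn_gt0 n_gt0 => /(_ isT le_nL).
pose H := harmonic_sum (n ^ 2).
have := harmonic_sum_square n; rewrite -/H => le_H le_D.
(* With [u = x / n] the logarithm is [4/3 ln (u^3)]; the cube is used because the target
   [2 x^3 = 2 n^3 u^3] is linear in [u^3]. *)
have ln_le : ln (L%:R / (n ^ 2)%:R ^+ 2) <= 4 / 3 * ((x / n%:R) ^+ 3 - 1) :> R.
  have u0 : 0 < x / n%:R by rewrite divr_gt0.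
  have -> : L%:R / (n ^ 2)%:R ^+ 2 = (x / n%:R) ^+ 4 :> R.
    by rewrite -xL natrX -exprM expr_div_n.
  have := ln_le_subr1 (exprn_gt0 3 u0); rewrite !lnXn //; lra.
have n_ge1 : 1 <= n%:R :> R by rewrite ler1n.
have en1 : n.-1%:R = n%:R - 1 :> R by rewrite -{2}(prednK n_gt0) -natr1 addrK.
rewrite natrM -xL en1 in le_H ln_le le_D *.
have -> : x ^+ 7 = x ^+ 4 * x ^+ 3 by rewrite -exprD.
set N : R := n%:R in n0 le_nx le_H ln_le le_D n_ge1 en1 *.
set D : R := _%:R in le_D *.
set l := ln _ in ln_le le_D *.
pose u := x / N; have xE : x = N * u by rewrite /u mulrC divfK // gt_eqF.
have u_ge1 : 1 <= u ^+ 3 by rewrite exprn_ege1 // /u ler_pdivlMr ?mul1r.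
have x4 : 0 < x ^+ 4 by rewrite exprn_gt0.
have key : N * (N - 1) * (4 * H - 3 + 2 * l) <= 2 * x ^+ 3.
  rewrite xE exprMn; rewrite -/u in ln_le; set w := u ^+ 3 in ln_le u_ge1 *.
  (* The harmonic part is at most [2 N^2], the logarithmic part at most [8/3 (N - 1) (w - 1)], hence
     at most [2 N^2 (w - 1)]. *)
  have : (N - 1) * (4 * H - 3 + 2 * l) <= 2 * N ^+ 2 * w.
    have : (N - 1) * (2 * l) <= (N - 1) * (8 / 3 * (w - 1)) by rewrite ler_wpM2l; lra.
    have : 4 * (N - 1) <= 3 * N ^+ 2 by nra.
    nra.
  by move=> /(ler_wpM2l (ltW n0)); rewrite [N ^+ 3]exprS !mulrA; lra.
have := ler_wpM2l (ltW x4) key.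
have : N * (N - 1) * (2 * D - x ^+ 4) <= N * (N - 1) * (x ^+ 4 * (4 * H - 3 + 2 * l)).
  by rewrite ler_wpM2l ?mulr_ge0 //; lra.
lra.
Qed.
End Harmonic.

(** * Divisibility between signed labels *)

Definition label_dvd_sym (L : nat) : rel (label L) := fun a b =>
  (label_val a %| label_val b)%Z || (label_val b %| label_val a)%Z.

Lemma label_dvd_sym_symmetric (L : nat) : symmetric (@label_dvd_sym L).
Proof. by move=> a b; rewrite /label_dvd_sym orbC. Qed.

Lemma absz_label_val (L : nat) (a : label L) : `|label_val a|%N = a.2.+1.
Proof. by rewrite /label_val abszM abszX absz_nat exp1n mul1n. Qed.

(** Divisibility ignores signs, so each pair of absolute values comes from four pairs of labels. *)
Lemma sum_label_dvd_sym (L : nat) :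
  (\sum_a \sum_b @label_dvd_sym L a b + 4 * L = 8 * divisor_sum L :> nat)%N.
Proof.
have -> : (8 * divisor_sum L = 4 * (2 * divisor_sum L))%N by rewrite mulnA.
rewrite -sum_dvdn_or_dvdn mulnDr; congr addn.
rewrite (_ : \sum_a _ = \sum_(p : bool * 'I_L) 2 *
    \sum_(b < L) ((p.2.+1 %| b.+1) || (b.+1 %| p.2.+1)))%N; last first.
  apply: eq_bigr => a _.
  transitivity (\sum_(q : bool * 'I_L) ((a.2.+1 %| q.2.+1) || (q.2.+1 %| a.2.+1)))%N.
    by apply: eq_bigr => b _; rewrite /label_dvd_sym !dvdzE !absz_label_val.
  by rewrite -(pair_bigA _ (fun _ b => (((a.2.+1 %| (b : 'I_L).+1) || (b.+1 %| a.2.+1)) : nat))%N)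
    /= sum_nat_const card_bool.
rewrite -(pair_bigA _ (fun _ a => 2 * \sum_(b < L) (((a : 'I_L).+1 %| b.+1) || (b.+1 %| a.+1)))%N).
by rewrite /= sum_nat_const card_bool -big_distrr /= mulnA.
Qed.

(** * Counting labellings and endpoint choices *)

Section RandomGraph.
Variables E L : nat.

(** Terminal vertices are ignored, so the event depends on the labels alone and covers every failure
    of rigidity, whatever the graph. *)
Definition label_collision : {set {ffun oedge E -> label L}} :=
  [set f : {ffun oedge E -> label L} | [exists e, exists e', (e != e') && label_dvd_sym (f e) (f e')]].

Lemma card_label : #|label L| = (2 * L)%N.
Proof. by rewrite card_prod card_bool card_ord. Qed.

Lemma card_oedge : #|oedge E| = (2 * E)%N.
Proof. by rewrite card_prod card_bool card_ord mulnC. Qed.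

Lemma card_label_collision :
  (2 * #|label_collision| * L ^ 2 <=
   (2 * E) * (2 * E).-1 * (2 * divisor_sum L - L) * #|{ffun oedge E -> label L}|)%N.
Proof.
have : (2 * #|label_collision| * #|label L| ^ 2 <=
   #|oedge E| * #|oedge E|.-1 * (\sum_a \sum_b @label_dvd_sym L a b) *
   #|{ffun oedge E -> label L}|)%N.
  by rewrite card_ffun; exact: card_ffun_collision (@label_dvd_sym_symmetric L).
have -> : (\sum_a \sum_b @label_dvd_sym L a b = 4 * (2 * divisor_sum L - L) :> nat)%N.
  (* The truncated subtraction is exact, since [L <= 2 * divisor_sum L]. *)
  apply: (@addIn (4 * L)%N); rewrite sum_label_dvd_sym.
  by have := sum_dvdn_or_dvdn L; lia.
rewrite card_oedge card_label; move: #|label_collision| #|{ffun _ -> _}| => c F.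
move: (2 * E * _)%N (_ - L)%N => P d.
(* The 4 in [(2 L)^2] cancels the four sign choices. *)
rewrite (_ : 2 * c * _ = 4 * (2 * c * L ^ 2))%N; last by ring.
by rewrite (_ : P * _ * F = 4 * (P * d * F))%N ?leq_pmul2l //; ring.
Qed.

Definition connected_endpoints (V : nat) : {set {ffun oedge E -> 'I_V}} :=
  [set v | is_connected (graph_of_endpoints v)].

(** Ensures that the conditional probability is a genuine quotient and not the default value 0. *)
Lemma connected_endpoints_gt0 (V : nat) : (0 < V)%N -> (V.-1 <= E)%N ->
  (0 < #|connected_endpoints V|)%N.
Proof.
case: V => // W _ /= le_WE; apply/card_gt0P.
(* A star centred at 0; the surplus edges all join 0 to the last vertex. *)
pose v : {ffun oedge E -> 'I_W.+1} :=
  [ffun h : oedge E => if h.2 then inord (minn h.1.+1 W) else ord0].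
exists v; rewrite inE; pose G := graph_of_endpoints v.
have adj (e : edge G) : adjacent (initial e) (terminal e).
  by apply/existsP; exists e; rewrite !eqxx.
have adj0 (x : 'I_W.+1) : x != ord0 ->
    @adjacent G ord0 x /\ @adjacent G x ord0.
  move=> nx0; have x_gt0 : (0 < x)%N by rewrite lt0n.
  (* Topological edge [x - 1] joins 0 to [x]; it exists because [x <= W <= E]. *)
  have lt_xE : (x.-1 < E)%N by have := ltn_ord x; lia.
  have vx : v (Ordinal lt_xE, true) = x.
    apply: val_inj; rewrite ffunE /= prednK // inordK; have := ltn_ord x; lia.
  have v0 : v (Ordinal lt_xE, false) = ord0 by rewrite ffunE.
  split.
    by have := adj (Ordinal lt_xE, false); rewrite /terminal /= v0 vx.
  by have := adj (Ordinal lt_xE, true); rewrite /terminal /= v0 vx.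
have conn0 (x : 'I_W.+1) : connect (@adjacent G) ord0 x && connect (@adjacent G) x ord0.
  have [->|/adj0[a0x ax0]] := eqVneq x ord0; first by rewrite connect0.
  by rewrite !connect1.
apply/forallP => x; apply/forallP => y.
have /andP[_ cx] := conn0 x; have /andP[cy _] := conn0 y.
exact: connect_trans cx cy.
Qed.

Lemma rigid_no_collision (V : nat) (w : outcome V E L) :
  w.2 \notin label_collision -> rigid (random_gbs w).
Proof.
apply: contraNN; rewrite inE => /existsP[e /existsP[e' /and3P[ne _ dvd]]].
by apply/existsP; exists e; apply/existsP; exists e'; rewrite ne /label_dvd_sym dvd.
Qed.

(** A product of uniform laws is uniform, so probabilities become counts. *)
Lemma Prob_uniform (R : realType) (V : nat) (A : {set outcome V E L}) :
  Prob R A = #|A|%:R / #|outcome V E L|%:R.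
Proof.
rewrite /Prob (eq_bigr (fun=> #|outcome V E L|%:R^-1)).
  by rewrite sumr_const -[LHS]mulr_natl.
move=> w _; rewrite /outcome_pmf /uniform_pmf !prodr_const !exprVn -invfM.
have -> : #|outcome V E L| = (#|'I_V| ^ #|oedge E| * #|label L| ^ #|oedge E|)%N.
  by rewrite -!card_ffun -card_prod.
by rewrite natrM !natrX.
Qed.
End RandomGraph.

(** * Conditioning on connectedness *)

Theorem theorem4 (R : realType) (V E L : nat)
    (V_gt0 : (0 < V)%N) (E_gt0 : (0 < E)%N) (L_gt0 : (0 < L)%N)
    (connected_possible : (V.-1 <= E)%N)
    (L_large : ((2 * E) ^ 4 <= L)%N) :
  1 - 1 / (L%:R `^ (4^-1)) <=
  CondProb R [set w : outcome V E L | rigid (random_gbs w)]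
             [set w : outcome V E L | is_connected (random_gbs w)].
Proof.
set A := [set w | rigid _]; set B := [set w | is_connected _].
set x := L%:R `^ _.
have L0 : 0 < L%:R :> R by rewrite ltr0n.
have x_gt0 : 0 < x by rewrite powR_gt0.
have xL : x ^+ 4 = L%:R.
  rewrite -powR_mulrn ?ltW // /x -powRrM mulVf ?pnatr_eq0 //; by rewrite powRr1 // ltW.
pose C := connected_endpoints E V; pose N := label_collision E L.
pose F := #|{ffun oedge E -> label L}|.
(* Connectedness involves only the endpoints, so conditioning leaves the labels uniform. *)
have cardB : #|B| = (#|C| * F)%N.
  have -> : B = setX C setT by apply/setP => w; rewrite !inE andbT.
  by rewrite cardsX cardsT.
have C_gt0 : (0 < #|C|)%N by exact: connected_endpoints_gt0.
have F_gt0 : (0 < F)%N.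
  by rewrite /F card_ffun card_label expn_gt0; apply/orP; left; lia.
(* A connected outcome that is not rigid lies in the product of [C] and [N]. *)
have card_nonrigid : (#|B| <= #|A :&: B| + #|C| * #|N|)%N.
  rewrite -cardsX -(cardsID A B) setIC leq_add2l subset_leq_card //.
  apply/subsetP => w; rewrite in_setD !inE /= => /andP[nr ->] /=.
  by move: nr; apply: contraNT => nN; apply: rigid_no_collision; rewrite inE.
have cardT_gt0 : (0 < #|outcome V E L|)%N.
  by apply: leq_trans (max_card (mem B)); rewrite cardB muln_gt0 C_gt0.
have -> : CondProb R A B = #|A :&: B|%:R / #|B|%:R.
  rewrite /CondProb !Prob_uniform -mulf_div divff ?mulr1 //.
  by rewrite invr_neq0 // pnatr_eq0 -lt0n.
have c0 : 0 < #|C|%:R :> R by rewrite ltr0n.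
have f0 : 0 < F%:R :> R by rewrite ltr0n.
have le_N : #|N|%:R * x <= F%:R :> R.
  have n_gt0 : (0 < 2 * E)%N by rewrite muln_gt0.
  have le_LD : (L <= 2 * divisor_sum L)%N.
    by rewrite -sum_dvdn_or_dvdn leq_addl.
  have := divisor_sum_fourth_root n_gt0 L_large x_gt0 xL.
  have := card_label_collision E L; rewrite -/N -/F -(ler_nat R).
  rewrite [leRHS]natrM [X in X * _]natrM natrB // (natrM R 2 (divisor_sum L)).
  rewrite [leLHS]natrM [X in X * _ <= _]natrM natrX -xL.
  move: (2 * E * _)%:R (divisor_sum L)%:R #|N|%:R => P D m le_m le_P.
  have x7 : 0 < x ^+ 7 by rewrite exprn_gt0.
  (* Scaling by [x^7] produces [x^8 = L^2], the factor in the collision count. *)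
  rewrite -(ler_pM2r x7) -mulrA -exprS.
  have := ler_wpM2r (ltW f0) le_P.
  rewrite -exprM in le_m.
  lra.
rewrite ler_pdivlMr ?cardB ?natrM ?mulr_gt0 // mulrBl mul1r.
move: card_nonrigid; rewrite cardB -(ler_nat R) natrD !natrM.
have : #|C|%:R * #|N|%:R <= 1 / x * (#|C|%:R * F%:R).
  rewrite mulrCA ler_pM2l // mul1r mulrC ler_pdivlMr //.
lra.
Qed.
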